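(* Let $(X,\mathcal A,\mathcal I)$ be a triple such that $\mathcal A\smallsetminus\mathcal I$ satisfies the countable chain condition and $X$ has the non-separation property with respect to $\mathcal A$. Then each infinite subset $E$ of $X$ decomposes into two disjoint full subsets, i.e. $E=E_1\cup E_2$ with $E_1\cap E_2=\emptyset$ and $E_1,E_2$ full subsets of $E$. Consequently, $E$ can be written as the union of an infinite family of pairwise disjoint subsets, each of which is a full subset of $E$ (equivalently, each of which is completely non-measurable in $E$).
   Context: A triple $(X,\mathcal A,\mathcal I)$ consists of a set $X$, a $\sigma$-algebra $\mathcal A$ of subsets of $X$ (called measurable sets) and a $\sigma$-ideal $\mathcal I$ of subsets of $X$ (called negligible sets) with $\mathcal I\subset\mathcal A$. For $E\subset Q\subset X$, $E$ is a full subset of $Q$ if for each $B\in\mathcal A$ with $E\subset B$ one has $Q\smallsetminus B\in\mathcal I$. A subset $E\subset Q$ is completely non-measurable in $Q$ if for each $A\in\mathcal A$ with $A\cap Q\notin\mathcal I$ one has $A\cap E\notin\mathcal I$ and $A\cap(Q\smallsetminus E)\notin\mathcal I$. Countable chain condition (CCC) for $\mathcal A\smallsetminus\mathcal I$: every disjoint family of non-negligible measurable sets is countable. Non-separation property of $X$ with respect to $\mathcal A$: for every $E\subset X$ with $E\notin\mathcal I$ there exist disjoint subsets $F,G$ of $E$ that cannot be separated by sets from $\mathcal A$, i.e. there is no $A\in\mathcal A$ with $F\subset A$ and $A\cap G=\emptyset$. *)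

(* Defs.v *)
From mathcomp Require Import all_boot.
From mathcomp Require Export all_classical.
From mathcomp Require Export measurable_structure.

Set Implicit Arguments.
Unset Strict Implicit.
Unset Printing Implicit Defensive.

Local Open Scope classical_set_scope.

Definition sigma_ideal (X : Type) (I : set (set X)) : Prop :=
  [/\ I set0,
      forall A B : set X, A `<=` B -> I B -> I A &
      forall A : nat -> set X, (forall n, I (A n)) -> I (\bigcup_n A n)].

Definition measurable_triple (X : Type) (A I : set (set X)) : Prop :=
  [/\ sigma_algebra setT A, sigma_ideal I & I `<=` A].

Definition full_subset (X : Type) (A I : set (set X)) (E Q : set X) : Prop :=
  E `<=` Q /\ forall B : set X, A B -> E `<=` B -> I (Q `\` B).

Definition completely_nonmeasurable (X : Type) (A I : set (set X))
    (E Q : set X) : Prop :=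
  E `<=` Q /\
  forall B : set X, A B -> ~ I (B `&` Q) ->
    ~ I (B `&` E) /\ ~ I (B `&` (Q `\` E)).

Definition countable_chain_condition (X : Type) (S : set (set X)) : Prop :=
  forall F : set (set X), F `<=` S -> trivIset F id -> countable F.

Definition separated_by (X : Type) (A : set (set X)) (F G : set X) : Prop :=
  exists B : set X, [/\ A B, F `<=` B & B `&` G = set0].

Definition non_separation_property (X : Type) (A I : set (set X)) : Prop :=
  forall E : set X, ~ I E ->
    exists F G : set X,
      [/\ F `<=` E, G `<=` E, F `&` G = set0 & ~ separated_by A F G].

(* The family is a set of sets, so its members are distinct; an indexed
   version could repeat the empty set infinitely often. *)
Definition infinite_decomposition (X : Type) (E : set X) (F : set (set X))
    : Prop :=
  [/\ infinite_set F, trivIset F id & \bigcup_(S in F) S = E].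

(* Main.v *)
(** Given non-separated disjoint sets [F] and [G], a maximal disjoint family of
    non-negligible measurable sets on which [F] or [G] is negligible is
    countable by the chain condition; the complement [M] of its union is
    non-negligible (otherwise [F] and [G] would be separated), and both [F] and
    [G] meet every non-negligible measurable subset of [M] in a non-negligible
    set.  Exhausting [E] by countably many disjoint sets of this kind and gluing
    the corresponding sets [F] yields a full subset of [E] whose complement in
    [E] is full as well.  As fullness is transitive, halving repeatedly gives
    infinitely many disjoint full subsets. *)
Require Import Defs.
From mathcomp Require Import all_boot all_classical.

Local Open Scope classical_set_scope.

(** An abstract class [G] lets this serve both measurable and negligible sets. A nonempty countable
    [D] is the image of a sequence; the empty one needs [G set0]. *)
Lemma bigcup_countable_closed {X T : Type} (G : set (set X)) (D : set T)
    (f : T -> set X) :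
  G set0 -> (forall g : nat -> set X, (forall n, G (g n)) -> G (\bigcup_n g n)) ->
  countable D -> (forall i, D i -> G (f i)) -> G (\bigcup_(i in D) f i).
Proof.
move=> G0 GU /pfcard_geP[->|[g]] Gf; first by rewrite bigcup_set0.
rewrite -[D](image_eq g) bigcup_image; apply: GU => n; apply: Gf.
exact: funS.
Qed.

Lemma infinite_image_inj {T U : Type} (f : T -> U) (D : set T) :
  {in D &, injective f} -> infinite_set D -> infinite_set (f @` D).
Proof. by move=> /inj_card_eq/eq_finite_set <-. Qed.

Section Triple.
Context {X : Type} {A I : set (set X)} (hT : measurable_triple A I).
Implicit Types B C E F G M S : set X.

Lemma negligible0 : I set0.
Proof. by case: hT => _ []. Qed.

Lemma sub_negligible B C : B `<=` C -> I C -> I B.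
Proof. by case: hT => _ [_ + _] _; exact. Qed.

Lemma negligible_bigcup {T : Type} (D : set T) (f : T -> set X) :
  countable D -> (forall i, D i -> I (f i)) -> I (\bigcup_(i in D) f i).
Proof. by case: hT => _ [I0 _ IU] _; exact: bigcup_countable_closed. Qed.

Lemma negligibleU B C : I B -> I C -> I (B `|` C).
Proof.
move=> IB IC; rewrite -bigcup2E; apply: negligible_bigcup => // -[|[|n]] _ //=.
exact: negligible0.
Qed.

Lemma negligible_measurable B : I B -> A B.
Proof. by case: hT => _ _; exact. Qed.

Lemma triple_bigcup {T : Type} (D : set T) (f : T -> set X) :
  countable D -> (forall i, D i -> A (f i)) -> A (\bigcup_(i in D) f i).
Proof. by case: hT => -[A0 _ AU] _ _; exact: bigcup_countable_closed. Qed.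

Lemma triple_setC B : A B -> A (~` B).
Proof. by case: hT => -[_ AC _] _ _ /AC; rewrite setTD. Qed.

Lemma triple_setU B C : A B -> A C -> A (B `|` C).
Proof.
move=> AB AC; rewrite -bigcup2E; apply: triple_bigcup => // -[|[|n]] _ //=.
exact/negligible_measurable/negligible0.
Qed.

Lemma triple_setD B C : A B -> A C -> A (B `\` C).
Proof.
move=> AB AC; have -> : B `\` C = ~` (~` B `|` C) by rewrite setCU setCK setDE.
by apply/triple_setC/triple_setU => //; exact: triple_setC.
Qed.

(** * Full and completely non-measurable subsets *)

Lemma full_subsetS S S' E :
  S `<=` S' -> S' `<=` E -> full_subset A I S E -> full_subset A I S' E.
Proof.
by move=> SS' S'E [_ h]; split=> // B AB S'B; apply: h => //; exact: subset_trans S'B.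
Qed.

Lemma full_subset_refl E : full_subset A I E E.
Proof.
split=> // B _ /subsets_disjoint; rewrite setDE => ->; exact: negligible0.
Qed.

(** The part of [S] outside [B] is negligible, hence measurable, so adding it to [B] gives a
    measurable set containing [S], on which fullness of [S] in [E] can be tested. *)
Lemma full_subset_trans F S E :
  full_subset A I F S -> full_subset A I S E -> full_subset A I F E.
Proof.
move=> [FS hF] [SE hS]; split=> [|B AB FB]; first exact: subset_trans SE.
have ISB := hF _ AB FB.
have AU : A (B `|` S `\` B) by apply: triple_setU => //; exact: negligible_measurable.
have SU : S `<=` B `|` S `\` B.
  by move=> x Sx; have [Bx|nBx] := pselect (B x); [left|right].
apply: sub_negligible (negligibleU _ _ ISB (hS _ AU SU)) => x [Ex nBx].
have [Sx|nSx] := pselect (S x); [by left|right; split=> //].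
by move=> [//|[]].
Qed.

Lemma full_subset_negligible S E : full_subset A I S E -> I S -> I E.
Proof.
move=> [_ h] IS; have IES := h _ (negligible_measurable _ IS) (@subset_refl _ S).
apply: sub_negligible (negligibleU _ _ IS IES) => x Ex.
by have [Sx|nSx] := pselect (S x); [left|right].
Qed.

(** Fullness is tested on the complement of [B] enlarged by the negligible trace of [S] on [B]: this
    set is measurable and contains [S]. *)
Lemma full_subset_meets S E B :
  full_subset A I S E -> A B -> I (B `&` S) -> I (B `&` E).
Proof.
move=> [_ h] AB IBS.
have AU : A (~` B `|` B `&` S).
  by apply: triple_setU; [exact: triple_setC|exact: negligible_measurable].
have SU : S `<=` ~` B `|` B `&` S.
  by move=> x Sx; have [Bx|nBx] := pselect (B x); [right|left].
apply: sub_negligible (negligibleU _ _ IBS (h _ AU SU)) => x [Bx Ex].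
have [Sx|nSx] := pselect (S x); [by left|right; split=> //].
by move=> [|[]].
Qed.

Lemma completely_nonmeasurable_full S E :
  completely_nonmeasurable A I S E -> full_subset A I S E.
Proof.
move=> [SE h]; split=> // B AB SB; rewrite setDE setIC; apply: contrapT => nI.
have [+ _] := h _ (triple_setC _ AB) nI; apply; rewrite setIC -setDE.
by move/subsets_disjoint: SB; rewrite setDE => ->; exact: negligible0.
Qed.

(** [S'] lies in the complement of [S] in [E], so that complement inherits from [S'] the property of
    meeting [B] in a non-negligible set. *)
Lemma full_completely_nonmeasurable S S' E :
  full_subset A I S E -> full_subset A I S' E -> S `&` S' = set0 ->
  completely_nonmeasurable A I S E.
Proof.
move=> fS fS' SS'0; split=> [|B AB nI]; first by case: fS.
split=> [/(full_subset_meets _ _ _ fS AB)//|IB]; apply: nI.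
apply: (full_subset_meets _ _ _ fS' AB); apply: sub_negligible IB => x [Bx S'x].
split=> //; split=> [|Sx]; first by case: fS' => + _; exact.
by have : (S `&` S') x by []; rewrite SS'0.
Qed.

(** * Exhaustion under the countable chain condition *)

Hypothesis hccc : countable_chain_condition (A `\` I).

Lemma ccc_exhaustion (P : set (set X)) :
  exists D : set (set X), [/\ countable D, D `<=` A `&` P, trivIset D id &
    forall C, A C -> P C -> C `&` \bigcup_(S in D) S = set0 -> I C].
Proof.
have [D [DAP tD maxD]] :=
  @ex_maximal_disjoint_subcollection (set X) X id ((A `\` I) `&` P).
exists D; split=> //.
- by apply: hccc => // S /DAP[].
- by move=> S /DAP[[AS _] PS].
- move=> C AC PC CD0; apply: contrapT => nIC.
  have disj S : D S -> ~ (C `&` S !=set0).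
    move=> DS [x [Cx Sx]]; have : (C `&` \bigcup_(S in D) S) x by split=> //; exists S.
    by rewrite CD0.
  apply: (maxD (D `|` [set C])).
  (* If [C] already belonged to [D], it would be disjoint from itself, hence empty and
     negligible. *)
  + split=> [S DS|/(_ C (or_intror erefl)) DC]; first by left.
    have /set0P/negP := disj _ DC; rewrite negbK setIid => /eqP C0.
    by apply: nIC; rewrite C0; exact: negligible0.
  + by move=> S [/DAP//|->].
  + move=> S S' [DS|->] [DS'|->] //.
    * exact: tD.
    * by rewrite setIC => /(disj _ DS).
    * by move/(disj _ DS').
Qed.

Lemma non_separated_kernel F G :
  F `&` G = set0 -> ~ separated_by A F G ->
  exists M, [/\ A M, ~ I M &
    forall C, A C -> C `<=` M -> I (F `&` C) \/ I (G `&` C) -> I C].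
Proof.
move=> FG0 nsep.
have [D [cD DAP _ maxD]] := ccc_exhaustion [set C | I (F `&` C) \/ I (G `&` C)].
pose DF := D `&` [set S | I (F `&` S)]; pose DG := D `&` [set S | I (G `&` S)].
pose U := \bigcup_(S in DF) S; pose V := \bigcup_(S in DG) S.
have cDF : countable DF by apply: sub_countable cD; apply: subset_card_le => S [].
have cDG : countable DG by apply: sub_countable cD; apply: subset_card_le => S [].
have AU : A U by apply: triple_bigcup => // S [/DAP[]].
have AV : A V by apply: triple_bigcup => // S [/DAP[]].
have IFU : I (F `&` U) by rewrite setI_bigcupr; apply: negligible_bigcup => // S [].
have IGV : I (G `&` V) by rewrite setI_bigcupr; apply: negligible_bigcup => // S [].
have DUV : \bigcup_(S in D) S `<=` U `|` V.
  by move=> x [S DS Sx]; have [_ [IS|IS]] := DAP _ DS; [left|right]; exists S.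
exists (~` (U `|` V)); split; first exact/triple_setC/triple_setU.
- move=> IM; apply: nsep.
  (* The separating set is [V] without its negligible trace of [G], plus two negligible pieces of
     [F]: the one in [U] and the one outside both unions. *)
  exists ((V `\` (G `&` V)) `|` (F `&` U `|` F `&` ~` (U `|` V))); split.
  + apply: triple_setU; first by apply: triple_setD => //; exact: negligible_measurable.
    apply: negligible_measurable; apply: negligibleU => //.
    exact: sub_negligible (@subIsetr _ _ _) IM.
  + move=> x Fx; have nGx : ~ G x by move=> Gx; have : (F `&` G) x by []; rewrite FG0.
    have [Ux|nUx] := pselect (U x); first by right; left.
    have [Vx|nVx] := pselect (V x); first by left; split=> // -[].
    by right; right; split=> // -[].
  + rewrite -subset0 => x [[[Vx nGV]|[[Fx _]|[Fx _]]] Gx]; first exact: nGV.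
      by rewrite -FG0.
    by rewrite -FG0.
- move=> C AC CM PC; apply: (maxD C) => //; rewrite -subset0 => x [Cx /DUV].
  exact: CM.
Qed.

(** * Halving and infinite decomposition *)

Hypothesis hns : non_separation_property A I.

Lemma full_halving E : exists E1, full_subset A I E1 E /\ full_subset A I (E `\` E1) E.
Proof.
(* The pair need not lie inside [M], so its sets are cut down to the blocks when glued. *)
pose P M := exists FG : set X * set X, [/\ FG.1 `<=` E, FG.2 `<=` E,
  FG.1 `&` FG.2 = set0 &
  forall C, A C -> C `<=` M -> I (FG.1 `&` C) \/ I (FG.2 `&` C) -> I C].
have [D [cD DAP tD maxD]] := ccc_exhaustion P.
have AD : A (\bigcup_(S in D) S) by apply: triple_bigcup => // S /DAP[].
have IR : I (E `\` \bigcup_(S in D) S).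
  (* A non-negligible remainder would contain a non-separated pair with kernel [M]. The part of [M]
     off the blocks satisfies [P], so it is negligible by maximality; it contains [F] cut to [M],
     which makes [M] negligible. *)
  apply: contrapT => /hns[F [G [FR GR FG0 /(non_separated_kernel _ _ FG0)]]].
  move=> [M [AM nIM hM]]; apply: (nIM); apply: (hM) => //; left.
  apply: (sub_negligible _ (M `\` \bigcup_(S in D) S)) => [x [/FR[]]//|].
  apply: maxD; first exact: triple_setD.
  - exists (F, G); split=> //=; [by move=> x /FR[]|by move=> x /GR[]|].
    by move=> C AC CM; apply: hM => // x /CM[].
  - by rewrite setDE -setIA setICl setI0.
have /choice[f hf] : forall S, exists FG : set X * set X, D S ->
    [/\ FG.1 `<=` E, FG.2 `<=` E, FG.1 `&` FG.2 = set0 &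
    forall C, A C -> C `<=` S -> I (FG.1 `&` C) \/ I (FG.2 `&` C) -> I C].
  move=> S; have [DS|nDS] := pselect (D S); last by exists (set0, set0).
  by have [_ [FG hFG]] := DAP _ DS; exists FG.
(* Each [S] minus [B] misses a set of its pair, hence is negligible; [E] minus [B] is covered by
   these and the remainder. *)
have full_of S0 : S0 `<=` E -> (forall B, S0 `<=` B -> forall S, D S ->
    (f S).1 `&` (S `\` B) = set0 \/ (f S).2 `&` (S `\` B) = set0) ->
    full_subset A I S0 E.
  move=> S0E h; split=> // B AB S0B.
  have IDB : I (\bigcup_(S in D) (S `\` B)).
    apply: negligible_bigcup => // S DS; have [_ _ _ hS] := hf _ DS.
    apply: hS; [|exact: subDsetl|].
      by apply: triple_setD => //; have [] := DAP _ DS.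
    by have [->|->] := h _ S0B _ DS; [left|right]; exact: negligible0.
  apply: sub_negligible (negligibleU _ _ IR IDB) => x [Ex nBx].
  have [[S DS Sx]|nDx] := pselect ((\bigcup_(S in D) S) x); last by left.
  by right; exists S.
exists (\bigcup_(S in D) ((f S).1 `&` S)); split; apply: full_of.
- by move=> x [S /hf[fE _ _ _] [/fE]].
- move=> B EB S DS; left; rewrite -subset0 => x [fx [Sx nBx]].
  by apply: nBx; apply: EB; exists S.
- exact: subDsetl.
- move=> B EB S DS; right; rewrite -subset0 => x [fx [Sx nBx]].
  have [_ fE f0 _] := hf _ DS.
  apply: nBx; apply: EB; split; first exact: fE.
  (* Disjointness of the blocks forces the second halves to avoid all the glued first halves. *)
  move=> [S' DS' [fS'x S'x]].
  have SS' : S = S' by apply: tD => //; exists x.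
  by suff : set0 x by []; rewrite -f0; split=> //; rewrite SS'.
Qed.

Lemma full_infinite_decomposition E : infinite_set E ->
  exists F : set (set X), infinite_decomposition E F /\
    (forall S, F S -> full_subset A I S E).
Proof.
move=> infE; have [IE|nIE] := pselect (I E).
  (* Every subset of a negligible set is full in it, so singletons suffice. *)
  exists (set1 @` E); split; last first.
    move=> _ [x Ex <-]; split=> [_ -> //|B _ _].
    exact: sub_negligible IE.
  split.
  - apply: infinite_image_inj infE => x y _ _ xy.
    by have : [set x] x by []; rewrite xy.
  - by move=> _ _ [x _ <-] [y _ <-] [z [-> ->]].
  - by rewrite bigcup_image bigcup_imset1 image_id.
have [h hh] := choice full_halving.
pose Q := fix Q n := if n is m.+1 then Q m `\` h (Q m) else E.
pose T n := h (Q n).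
have fullQ n : full_subset A I (Q n) E.
  elim: n => [|n]; first exact: full_subset_refl.
  by apply: full_subset_trans; have [] := hh (Q n).
have fullT n : full_subset A I (T n) E.
  by apply: full_subset_trans (fullQ n); have [] := hh (Q n).
have T0 n : T n !=set0.
  apply/set0P/eqP => T0; apply/nIE/(full_subset_negligible _ _ (fullT n)).
  by rewrite T0; exact: negligible0.
have TQ n : T n `<=` Q n by have [[]] := hh (Q n).
have QD m n : (m < n)%N -> Q n `<=` Q m `\` T m.
  elim: n => // n IH; rewrite ltnS leq_eqVlt => /predU1P[->//|/IH QnQm].
  by move=> x [/QnQm].
have tT : trivIset setT T.
  apply: ltn_trivIset => n m mn; rewrite -subset0 => x [Tmx].
  by move/TQ/(QD _ _ mn) => -[].
(* The sets [T n] need not exhaust [E]. Leaving [T 0] out of the union puts it inside the remainder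
   [R], which makes [R] full. *)
pose R := E `\` \bigcup_n T n.+1.
exists (R |` range (fun n => T n.+1)); split; last first.
  move=> _ [->|[n _ <-]]; last exact: fullT.
  apply: (full_subsetS (T 0)) (fullT 0); last exact: subDsetl.
  move=> x T0x; split; first by have [+ _] := fullT 0; exact.
  by move=> [n _ Tnx]; have := tT 0 n.+1 Logic.I Logic.I (ex_intro _ x (conj T0x Tnx)).
split.
- rewrite finite_setU => -[_]; apply: infinite_image_inj infinite_nat => m n _ _ mn.
  have [x Tx] := T0 m.+1.
  by apply/succn_inj/tT => //; exists x; split=> //; rewrite -mn.
- move=> _ _ [->|[n _ <-]] [->|[m _ <-]] //.
  + by move=> [x [[_ nT] Tx]]; exfalso; apply: nT; exists m.
  + by move=> [x [Tx [_ nT]]]; exfalso; apply: nT; exists n.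
  + by move/(tT _ _ Logic.I Logic.I) => ->.
- apply/seteqP; split=> [x [_ [->|[n _ <-]]]|x Ex]; first by case.
    by have [+ _] := fullT n.+1; exact.
  have [[n _ Tx]|nTx] := pselect ((\bigcup_n T n.+1) x).
    by exists (T n.+1) => //; right; exists n.
  by exists R => //; left.
Qed.

End Triple.

Theorem theorem2p4 (X : Type) (A I : set (set X))
  (hT : measurable_triple A I)
  (hccc : countable_chain_condition (A `\` I))
  (hns : non_separation_property A I)
  (E : set X) (hE : infinite_set E) :
  [/\ exists E1 E2 : set X,
        [/\ E = E1 `|` E2, E1 `&` E2 = set0,
            full_subset A I E1 E & full_subset A I E2 E],
      exists F : set (set X),
        infinite_decomposition E F /\
        (forall S : set X, F S -> full_subset A I S E) &
      forall F : set (set X), infinite_decomposition E F ->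
        ((forall S : set X, F S -> full_subset A I S E) <->
         (forall S : set X, F S -> completely_nonmeasurable A I S E))].
Proof.
split.
- have [E1 [fE1 fE2]] := full_halving hT hccc hns E.
  exists E1, (E `\` E1); split=> //; last by rewrite setDIK.
  by rewrite setDUK //; case: fE1.
- exact: full_infinite_decomposition hT hccc hns E hE.
- move=> F [infF tF _]; split=> hF S FS.
  (* An infinite family has a second member, which is full and disjoint from [S]. *)
  + have [S' [FS' S'S]] : (F `\` [set S]) !=set0.
      by apply/infinite_setN0/infinite_setD.
    apply: (full_completely_nonmeasurable hT S S' E (hF _ FS) (hF _ FS')).
    apply: contrapT => /eqP/set0P/(tF _ _ FS FS') SS'.
    by apply: S'S; rewrite SS'.
  + exact: (completely_nonmeasurable_full hT _ _ (hF _ FS)).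
Qed.
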